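(* There is no Eisenstein lattice equable parallelogram having a vertical diagonal.
   Context: A planar polygon is equable if its perimeter equals its area. The Eisenstein lattice is $\mathbb{Z}[\omega]\subset\mathbb{C}$, where $\omega=-\frac12+i\frac{\sqrt3}{2}$. An Eisenstein lattice equable parallelogram (ELEP) is an equable parallelogram whose vertices all lie in $\mathbb{Z}[\omega]$. Vertical means parallel to the imaginary axis. *)

(* Defs.v *)
From Stdlib Require Export Reals List.
From Coquelicot Require Export Coquelicot.
Import ListNotations.

Local Open Scope C_scope.

(** The plane is Coquelicot's complex plane [C = R * R], over Stdlib's [R]. *)

Definition omega : C := ((- 1 / 2)%R, (sqrt 3 / 2)%R).

Definition eisenstein (z : C) : Prop :=
  exists m n : Z, z = RtoC (IZR m) + RtoC (IZR n) * omega.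

Definition cross (u v : C) : R := (Re u * Im v - Im u * Re v)%R.

Definition parallel (u v : C) : Prop :=
  u <> 0 /\ v <> 0 /\ cross u v = 0%R.

Definition collinear (a b c : C) : Prop := cross (b - a) (c - a) = 0%R.

(** A polygon is the list of its vertices in cyclic order; its sides include
    the closing one, from the last vertex back to the first. *)
Definition sides (p : list C) : list (C * C) :=
  match p with
  | [] => []
  | a :: q => combine p (q ++ [a])
  end.

Definition Rsum (l : list R) : R := fold_right Rplus 0%R l.

Definition perimeter (p : list C) : R :=
  Rsum (map (fun s => Cmod (snd s - fst s)) (sides p)).

(** Shoelace formula: the enclosed area when [p] is a simple polygon. *)
Definition area (p : list C) : R :=
  (Rabs (Rsum (map (fun s => cross (fst s) (snd s)) (sides p))) / 2)%R.

Definition equable (p : list C) : Prop := perimeter p = area p.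

(** A quadrilateral [abcd] with both pairs of opposite sides parallel.
    Non-collinearity excludes flat quadrilaterals; it makes the sides [bc] and
    [ad] meet the lines of [ab] and [cd] transversally, so [d = a + c - b]. *)
Definition parallelogram (a b c d : C) : Prop :=
  ~ collinear a b c /\ parallel (b - a) (c - d) /\ parallel (c - b) (d - a).

Definition ELEP (a b c d : C) : Prop :=
  parallelogram a b c d /\
  (eisenstein a /\ eisenstein b /\ eisenstein c /\ eisenstein d) /\
  equable [a; b; c; d].

Definition vertical (a b : C) : Prop := parallel (b - a) Ci.

(* Main.v *)
(** The sides of the parallelogram are Eisenstein integers [u], [v] with
    [2(|u| + |v|) = |det(u, v)| * sqrt 3 / 2]. Hence [|u|] and [|v|] are rational
    multiples of [sqrt 3], so [N(u) = 3 p^2] and [N(v) = 3 q^2] with [p], [q]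
    integers. A vertical diagonal is [m * sqrt(-3)] with [m] an integer, and
    equability becomes [3 |b m| = 4 (p + q)], where [3 b = 2 x - y] for
    [u = x + y omega]. Heron's formula for the triangle with sides [p], [q], [m]
    then reads [(9 b^2 - 16) f = 48 b^2], where [f = m^2 - (p - q)^2]. For
    [b^2 >= 25] this forces [5 < f < 6]; for smaller [b] the only integral
    solution with [b <> 0] is [f = 6], which is not a difference of two squares. *)

From Stdlib Require Import ZArith Lia Lra.
Require Import Defs.

(** An integer that is the square of a rational [k / n] is a perfect square: in lowest terms the
    denominator divides the numerator, so it is a unit. *)
Lemma square_of_rational_square (n k M : Z) :
  (n <> 0 -> n * n * M = k * k -> exists r, M = r * r)%Z.
Proof.
  intros Hn H.
  assert (Hg : Z.gcd n k <> 0%Z).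
  { intros E. apply Z.gcd_eq_0_l in E. contradiction. }
  pose proof (Z.gcd_div_gcd n k _ Hg eq_refl) as Hc.
  pose proof (Z.gcd_divide_l n k) as [n' Hn'].
  pose proof (Z.gcd_divide_r n k) as [k' Hk'].
  set (g := Z.gcd n k) in *. clearbody g. subst n k.
  rewrite !Z.div_mul in Hc by exact Hg.
  assert (H' : (n' * n' * M = k' * k')%Z).
  { apply (Z.mul_reg_l _ _ (g * g)); [nia|].
    transitivity (n' * g * (n' * g) * M)%Z; [ring|].
    rewrite H. ring. }
  assert (D : (n' | k')%Z).
  { apply (Z.gauss _ k'); [|exact Hc]. exists (n' * M)%Z. rewrite <- H'. ring. }
  assert (D1 : (n' | 1)%Z).
  { rewrite <- Hc. apply Z.gcd_greatest; [apply Z.divide_refl|exact D]. }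
  exists k'. apply Z.divide_1_r in D1. destruct D1 as [-> | ->]; lia.
Qed.

Lemma Z_divide_3_square (a : Z) : (3 | a * a)%Z -> (3 | a)%Z.
Proof.
  intros [k Hk]. pose proof (Z.div_mod a 3 ltac:(lia)) as E.
  pose proof (Z.mod_pos_bound a 3 ltac:(lia)) as B.
  exists (a / 3)%Z.
  assert (C : (a mod 3 = 0 \/ a mod 3 = 1 \/ a mod 3 = 2)%Z) by lia.
  destruct C as [C | [C | C]]; rewrite C in E; [lia | |]; exfalso;
    set (c := (a / 3)%Z) in *; nia.
Qed.

Lemma no_integral_triangle (x y m p q : Z) :
  (x * x - x * y + y * y = 3 * (p * p) ->
   (m - x) * (m - x) - (m - x) * (2 * m - y) + (2 * m - y) * (2 * m - y)
     = 3 * (q * q) ->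
   (m * (2 * x - y)) * (m * (2 * x - y)) = 16 * ((p + q) * (p + q)) ->
   m * (2 * x - y) <> 0 -> False)%Z.
Proof.
  intros Hp Hq HD Hnz.
  (* The norm is [(x + y)^2 - 3 x y]. *)
  assert (D : (3 | x + y)%Z).
  { apply Z_divide_3_square. exists (p * p + x * y)%Z. lia. }
  destruct D as [c Hc].
  set (b := (x - c)%Z).
  assert (Hy : y = (2 * x - 3 * b)%Z) by (unfold b; lia).
  clearbody b; subst y; clear c Hc.
  replace (2 * x - (2 * x - 3 * b))%Z with (3 * b)%Z in * by ring.
  assert (Hp' : (p * p = x * x - 3 * b * x + 3 * b * b)%Z) by lia.
  assert (Hq' : (q * q = (m - x) * (m - x) + 3 * b * (m - x) + 3 * b * b)%Z) by lia.
  assert (Hm : m <> 0%Z) by nia.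
  assert (Hb : b <> 0%Z) by nia.
  (* With [v] the second side, [u + v = m * sqrt(-3)] and [u - v = 3 b + e * sqrt(-3)]. *)
  set (e := (2 * x - m - 3 * b)%Z).
  assert (He : ((p + q) * (p - q) = m * e)%Z) by (unfold e; nia).
  assert (He2 : (9 * (b * b) * ((p - q) * (p - q)) = 16 * (e * e))%Z).
  { apply (Z.mul_reg_l _ _ (m * m)); [nia|].
    transitivity (m * (3 * b) * (m * (3 * b)) * ((p - q) * (p - q)))%Z; [ring|].
    rewrite HD.
    transitivity (16 * ((p + q) * (p - q) * ((p + q) * (p - q))))%Z; [ring|].
    rewrite He. ring. }
  (* The parallelogram law for [u] and [v], divided by 3. *)
  assert (Hs : ((p + q) * (p + q) + (p - q) * (p - q) = 3 * b * b + e * e + m * m)%Z).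
  { unfold e. lia. }
  set (d := (p - q)%Z) in *.
  (* Multiply [Hs] by 16, then eliminate [p + q] by [HD] and [e] by [He2]. *)
  assert (HF : ((9 * (b * b) - 16) * (m * m - d * d) = 48 * (b * b))%Z) by lia.
  (* A difference of two squares is never 2 modulo 4. *)
  assert (Hmod : (m * m - d * d <> 6)%Z).
  { intros E.
    destruct (Z.Even_or_Odd m) as [[k Hk] | [k Hk]];
    destruct (Z.Even_or_Odd d) as [[l Hl] | [l Hl]]; rewrite Hk, Hl in E; lia. }
  set (f := (m * m - d * d)%Z) in *; clearbody f.
  assert (Hcase : (b * b = 1 \/ b * b = 4 \/ b * b = 9 \/ b * b = 16 \/ b * b >= 25)%Z).
  { clear - Hb.
    assert (C : (b <= -5 \/ b = -4 \/ b = -3 \/ b = -2 \/ b = -1 \/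
                 b = 1 \/ b = 2 \/ b = 3 \/ b = 4 \/ b >= 5)%Z) by lia.
    destruct C as [C|[->|[->|[->|[->|[->|[->|[->|[->|C]]]]]]]]]; try lia;
      do 4 right; nia. }
  set (B := (b * b)%Z) in *; clearbody B.
  clear - HF Hmod Hcase.
  destruct Hcase as [-> | [-> | [-> | [-> | C]]]]; try lia.
  assert (L : (f <= 5 \/ f >= 6)%Z) by lia.
  destruct L; nia.
Qed.

Local Open Scope R_scope.

(** Isolating [sqrt B] and squaring shows that [sqrt (3 A)] is rational, since [D] is nonzero. So
    [3 A] is a square [r^2], and 3 divides [r]. *)
Lemma norm_of_equable_sides (A B D : Z) :
  (0 <= A)%Z -> (0 <= B)%Z -> D <> 0%Z ->
  4 * (sqrt (IZR A) + sqrt (IZR B)) = sqrt 3 * IZR D ->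
  exists p, sqrt (IZR A) = sqrt 3 * IZR p /\ A = (3 * (p * p))%Z.
Proof.
  intros HA HB HD H.
  pose proof (sqrt_sqrt _ (IZR_le _ _ HA)) as SA.
  pose proof (sqrt_sqrt _ (IZR_le _ _ HB)) as SB.
  pose proof (sqrt_sqrt 3 ltac:(lra)) as S3.
  pose proof (sqrt_pos (IZR A)) as PA.
  pose proof (sqrt_lt_R0 3 ltac:(lra)) as P3.
  set (a := sqrt (IZR A)) in *. set (b := sqrt (IZR B)) in *.
  set (t := sqrt 3) in *.
  assert (E : 8 * IZR D * (t * a) = 3 * (IZR D * IZR D) + 16 * (IZR A - IZR B)).
  { assert (Eb : 4 * b = t * IZR D - 4 * a) by lra.
    assert (Eb2 : (4 * b) * (4 * b) = (t * IZR D - 4 * a) * (t * IZR D - 4 * a))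
      by (rewrite Eb; reflexivity).
    replace ((4 * b) * (4 * b)) with (16 * (b * b)) in Eb2 by ring.
    replace ((t * IZR D - 4 * a) * (t * IZR D - 4 * a))
      with ((t * t) * (IZR D * IZR D) - 8 * IZR D * (t * a) + 16 * (a * a)) in Eb2 by ring.
    rewrite SA, SB, S3 in Eb2. lra. }
  destruct (square_of_rational_square (8 * D) (3 * (D * D) + 16 * (A - B)) (3 * A))
    as [r Hr].
  - lia.
  - apply eq_IZR. repeat rewrite ?mult_IZR, ?plus_IZR, ?minus_IZR.
    rewrite <- E, <- SA. replace 3 with (t * t) at 1 by exact S3. ring.
  - destruct (Z_divide_3_square r) as [p0 Hp0].
    { exists A. lia. }
    (* The absolute value makes [sqrt (p * p)] equal to [p]. *)
    set (p := Z.abs p0).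
    assert (Hp : A = (3 * (p * p))%Z).
    { unfold p. rewrite <- Z.abs_mul, Z.abs_eq by nia. nia. }
    exists p. split; [|exact Hp].
    unfold a. rewrite Hp, !mult_IZR, sqrt_mult_alt, sqrt_square; [reflexivity| |lra].
    apply IZR_le. apply Z.abs_nonneg.
Qed.

(** The number [x + y * omega] in Cartesian coordinates. *)
Definition eis (x y : Z) : C := (IZR x - IZR y / 2, sqrt 3 / 2 * IZR y).

Lemma eisenstein_eis (z : C) : eisenstein z -> exists x y, z = eis x y.
Proof.
  intros (x & y & ->). exists x, y.
  unfold eis, omega, RtoC, Cplus, Cmult. simpl. f_equal; field.
Qed.

Lemma Cmod_eis (x y : Z) : Cmod (eis x y) = sqrt (IZR (x * x - x * y + y * y)).
Proof.
  unfold Cmod, eis. simpl. f_equal.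
  pose proof (sqrt_sqrt 3 ltac:(lra)) as S3.
  rewrite plus_IZR, minus_IZR, !mult_IZR.
  transitivity ((IZR x - IZR y / 2) * (IZR x - IZR y / 2)
    + (sqrt 3 * sqrt 3) / 4 * (IZR y * IZR y)); [field|].
  rewrite S3. field.
Qed.

Lemma cross_eis (x y x' y' : Z) :
  cross (eis x y) (eis x' y') = sqrt 3 / 2 * IZR (x * y' - y * x').
Proof.
  unfold cross, eis. simpl. rewrite minus_IZR, !mult_IZR. field.
Qed.

Lemma no_equable_sides (u v : C) :
  eisenstein u -> eisenstein v ->
  cross u v <> 0 -> 2 * (Cmod u + Cmod v) = Rabs (cross u v) ->
  Re u + Re v <> 0.
Proof.
  intros Hu Hv Hc He H0.
  destruct (eisenstein_eis u Hu) as (x & y & ->).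
  destruct (eisenstein_eis v Hv) as (x' & y' & ->).
  pose proof (sqrt_lt_R0 3 ltac:(lra)) as P3.
  set (m := (x + x')%Z).
  assert (Hy : (y' = 2 * m - y)%Z).
  { apply eq_IZR. unfold m. unfold eis in H0. simpl in H0.
    rewrite minus_IZR, mult_IZR, plus_IZR. lra. }
  assert (Hx : (x' = m - x)%Z) by (unfold m; lia).
  clearbody m; subst x' y'.
  rewrite cross_eis in Hc, He.
  replace (x * (2 * m - y) - y * (m - x))%Z with (m * (2 * x - y))%Z in Hc, He by ring.
  rewrite !Cmod_eis in He.
  rewrite Rabs_mult, (Rabs_right (sqrt 3 / 2)), <- abs_IZR in He by lra.
  set (A := (x * x - x * y + y * y)%Z) in *.
  set (B := ((m - x) * (m - x) - (m - x) * (2 * m - y) + (2 * m - y) * (2 * m - y))%Z) in *.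
  assert (HA : (0 <= A)%Z) by (unfold A; nia).
  assert (HB : (0 <= B)%Z).
  { unfold B. generalize (m - x)%Z (2 * m - y)%Z. intros; nia. }
  assert (HD : (m * (2 * x - y) <> 0)%Z).
  { intros E. apply Hc. rewrite E. ring. }
  destruct (norm_of_equable_sides A B (Z.abs (m * (2 * x - y)))) as (p & Hp & Ep);
    try lia; try lra.
  destruct (norm_of_equable_sides B A (Z.abs (m * (2 * x - y)))) as (q & Hq & Eq);
    try lia; try lra.
  assert (HS : (Z.abs (m * (2 * x - y)) = 4 * (p + q))%Z).
  { apply eq_IZR. rewrite mult_IZR, plus_IZR.
    apply (Rmult_eq_reg_l (sqrt 3)); [|lra]. lra. }
  apply (no_integral_triangle x y m p q); auto.
  rewrite <- (Z.abs_square (m * (2 * x - y))), HS. ring.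
Qed.

Lemma eisenstein_minus (z w : C) : eisenstein z -> eisenstein w -> eisenstein (z - w)%C.
Proof.
  intros (m & n & ->) (m' & n' & ->). exists (m - m')%Z, (n - n')%Z.
  rewrite !minus_IZR, !RtoC_minus. ring.
Qed.

(** The two parallelism conditions are linear in [d]; Cramer's rule applies because their
    determinant is, up to sign, [K], nonzero by non-collinearity. *)
Lemma parallelogram_fourth_vertex (a b c d : C) :
  parallelogram a b c d -> d = (a + c - b)%C.
Proof.
  destruct a as [a1 a2], b as [b1 b2], c as [c1 c2], d as [d1 d2].
  unfold parallelogram, collinear, parallel, cross, Cminus, Copp, Cplus. simpl.
  intros (Hc & (_ & _ & H1) & (_ & _ & H2)).
  set (K := (b1 - a1) * (c2 - b2) - (b2 - a2) * (c1 - b1)).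
  assert (HK : K <> 0) by (intros E; apply Hc; unfold K in E; lra).
  pose proof (f_equal (Rmult (c1 - b1)) H1). pose proof (f_equal (Rmult (c2 - b2)) H1).
  pose proof (f_equal (Rmult (b1 - a1)) H2). pose proof (f_equal (Rmult (b2 - a2)) H2).
  f_equal; apply (Rmult_eq_reg_l K); try exact HK; unfold K; lra.
Qed.

Theorem theorem6 :
  ~ exists a b c d : C,
      ELEP a b c d /\ (vertical a c \/ vertical b d).
Proof.
  intros (a & b & c & d & (Hpar & (Ha & Hb & Hc & Hd) & Heq) & Hvert).
  pose proof (parallelogram_fourth_vertex _ _ _ _ Hpar) as Ed.
  destruct Hpar as (Hcol & _ & _).
  assert (Hcross : cross (b - a)%C (c - b)%C <> 0).
  { intros E. apply Hcol. unfold collinear. rewrite <- E.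
    unfold cross. simpl. ring. }
  assert (Hsides : 2 * (Cmod (b - a)%C + Cmod (c - b)%C) = Rabs (cross (b - a)%C (c - b)%C)).
  { unfold equable, perimeter, area in Heq. simpl in Heq.
    replace (d - c)%C with (- (b - a))%C in Heq by (rewrite Ed; ring).
    replace (a - d)%C with (- (c - b))%C in Heq by (rewrite Ed; ring).
    rewrite !Cmod_opp in Heq.
    (* Once [d] is eliminated, the shoelace sum is twice the cross product of adjacent sides. *)
    match type of Heq with _ = Rabs ?s / 2 =>
      replace s with (2 * cross (b - a)%C (c - b)%C) in Heq
        by (rewrite Ed; unfold cross, Re, Im; simpl; ring) end.
    rewrite Rabs_mult, (Rabs_right 2) in Heq by lra. lra. }
  destruct Hvert as [(_ & _ & V) | (_ & _ & V)]; unfold cross in V; simpl in V.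
  - apply (no_equable_sides (b - a)%C (c - b)%C); auto using eisenstein_minus.
    simpl. lra.
  (* The other diagonal is [d - b = (a - b) + (c - b)], so one side is reversed. *)
  - assert (Hcross' : cross (a - b)%C (c - b)%C = - cross (b - a)%C (c - b)%C)
      by (unfold cross; simpl; ring).
    apply (no_equable_sides (a - b)%C (c - b)%C); auto using eisenstein_minus.
    + rewrite Hcross'. lra.
    + rewrite Hcross', Rabs_Ropp, <- Hsides, <- (Cmod_opp (a - b)%C).
      do 3 f_equal. ring.
    + rewrite Ed in V. simpl in V |- *. lra.
Qed.
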